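(* For every $\varepsilon>0$ there exist an integer $d_\varepsilon$ and a function $f$ on the positive integers with $f(d)\le 1/2$, such that for all integers $d\ge d_\varepsilon$ and $N\ge1$, and every point $\mathbf a\in\mathcal W(d,N)$ with $\operatorname{dist}_d(\mathbf a,\mathbf c)\ge f(d)$, the proportion of triangles $(\mathbf a,\mathbf c,\mathbf v)$ with $\mathbf v\in\mathcal V(d,N)$ whose angle $\theta_{\mathbf c}(\mathbf v)$ at $\mathbf c$ satisfies $|\cos\theta_{\mathbf c}(\mathbf v)|\le\varepsilon$ is at least $1-\varepsilon$.
   Context: For integers $d,N\ge1$, $\mathcal W(d,N)=\{0,1,\dots,N\}^d$ and $\mathcal V(d,N)=\{0,N\}^d$ is the set of the $2^d$ vertices of $[0,N]^d$; $\mathbf c=(N/2,\dots,N/2)$ is the center of the hypercube. The normalized distance is $\operatorname{dist}_d(\mathbf u,\mathbf v)=\frac{1}{\sqrt d\,N}\bigl(\sum_{j=1}^d(u_j-v_j)^2\bigr)^{1/2}$. The proportion is taken over the $2^d$ vertices $\mathbf v$. *)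

(* Defs.v *)
From mathcomp Require Import all_boot all_order all_algebra.
From mathcomp Require Import reals trigo.

Set Implicit Arguments.
Unset Strict Implicit.
Unset Printing Implicit Defensive.

Import Order.TTheory GRing.Theory Num.Theory.
Local Open Scope ring_scope.

(* W(d, N) = {0, ..., N}^d *)
Definition lattice (d N : nat) := {ffun 'I_d -> 'I_N.+1}.

(* V(d, N) = {0, N}^d, as a subset of W(d, N) *)
Definition vertices (d N : nat) : {set lattice d N} :=
  [set v : lattice d N | [forall j, (v j == 0%N :> nat) || (v j == N :> nat)]].

Lemma card_vertices d N : (0 < N)%N -> #|vertices d N| = (2 ^ d)%N.
Proof.
move=> N0.
have -> : #|vertices d N| = #|@ffun_on 'I_d [set ord0; @ord_max N]|.
  apply: eq_card => v; rewrite inE.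
  apply/forallP/ffun_onP => H j; have := H j; by rewrite !inE.
rewrite card_ffun_on card_ord cards2.
by rewrite (_ : ord0 != ord_max) //; apply/eqP => /(congr1 val) /= NE; rewrite -NE in N0.
Qed.

Section Geometry.
Variables (R : realType) (d : nat).
Implicit Types u v w : 'rV[R]_d.

Definition point (N : nat) (a : lattice d N) : 'rV[R]_d := \row_j (a j)%:R.

Definition center (N : nat) : 'rV[R]_d := \row_j (N%:R / 2).

Definition dotp u v : R := \sum_(j < d) u 0 j * v 0 j.

(* the library's norm on row vectors is the sup norm *)
Definition enorm u : R := Num.sqrt (\sum_(j < d) u 0 j ^+ 2).

Definition ndist (N : nat) u v : R :=
  (Num.sqrt d%:R * N%:R)^-1 * Num.sqrt (\sum_(j < d) (u 0 j - v 0 j) ^+ 2).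

(* Angle at w of the triangle (u, w, v); meaningful only if u != w and v != w. *)
Definition angle u w v : R :=
  acos (dotp (u - w) (v - w) / (enorm (u - w) * enorm (v - w))).

(* Proportion of the vertices v for which the angle at the center c of the
   triangle (a, c, v) is defined and has a cosine of absolute value at most eps.
   (v != c always holds when d, N > 0, so the angle is defined iff a != c;
   without this guard the value 0^-1 = 0 would count a = c as a success.) *)
Definition almost_right_proportion (N : nat) (a : lattice d N) (eps : R) : R :=
  #|[set v in vertices d N | (point a != center N) &&
      (`|cos (angle (point a) (center N) (point v))| <= eps)]|%:R
  / #|vertices d N|%:R.

End Geometry.

(* Main.v *)
Require Import Defs.
From mathcomp Require Import all_boot all_order all_algebra.
From mathcomp Require Import reals trigo.
From mathcomp Require Import zify ring lra.
Set Implicit Arguments.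
Unset Strict Implicit.
Unset Printing Implicit Defensive.
Import Order.TTheory GRing.Theory Num.Theory.
Local Open Scope ring_scope.

(** Write [x = a - c] and [y = v - c].  The coordinates of [y] are [+- N/2], and
    reflecting one coordinate of [v] shows that distinct coordinates of [y] are
    uncorrelated over the vertices.  Hence the mean of [<x, y>^2] is
    [(N/2)^2 |x|^2], so the mean of [cos^2] is [1/d] as soon as [a != c], and
    Chebyshev's inequality bounds the proportion of vertices with
    [|cos| > eps] by [1 / (d eps^2)].  Any positive [f] therefore works. *)

(** Markov's inequality in counting form: discard the terms with [F x <= t], which are nonnegative,
    and bound the others below by [t]. *)
Lemma markov_card (R : realFieldType) (T : finType) (A : {set T}) (F : T -> R)
    (t : R) :
  (forall x, x \in A -> 0 <= F x) ->
  #|[set x in A | t < F x]|%:R * t <= \sum_(x in A) F x.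
Proof.
move=> F0; rewrite mulr_natl -sumr_const [leRHS](big_setID [set x in A | t < F x]) /=.
have /setIidPr -> : [set x in A | t < F x] \subset A.
  by apply/subsetP => x; rewrite inE => /andP[].
rewrite -[leLHS]addr0 lerD //.
  by apply: ler_sum => x; rewrite inE => /andP[_ /ltW].
by apply: sumr_ge0 => x; rewrite inE => /andP[_]; apply: F0.
Qed.

Section EuclideanNorm.
Variables (R : realType) (d : nat).
Implicit Types u v w : 'rV[R]_d.

Lemma enorm_ge0 u : 0 <= enorm u.
Proof. exact: sqrtr_ge0. Qed.

Lemma sqr_enorm u : enorm u ^+ 2 = \sum_(j < d) u 0 j ^+ 2.
Proof. by rewrite sqr_sqrtr // sumr_ge0 // => j _; apply: sqr_ge0. Qed.

Lemma enorm_eq0 u : (enorm u == 0) = (u == 0).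
Proof.
rewrite -sqrf_eq0 sqr_enorm psumr_eq0; last by move=> j _; apply: sqr_ge0.
apply/allP/eqP => [u0|-> j _]; last by rewrite mxE expr0n /= eqxx.
apply/rowP => j; rewrite mxE; apply/eqP.
by have := u0 j (mem_index_enum j); rewrite sqrf_eq0.
Qed.

Lemma cauchy_schwarz u v : dotp u v ^+ 2 <= enorm u ^+ 2 * enorm v ^+ 2.
Proof.
have [/eqP|v0] := eqVneq (enorm v) 0.
  rewrite enorm_eq0 => /eqP ->.
  rewrite -exprMn /dotp big1 ?expr0n ?sqr_ge0 // => j _.
  by rewrite mxE mulr0.
set D := dotp u v; set B := enorm v ^+ 2.
have B0 : 0 < B by rewrite exprn_gt0 // lt_def v0 enorm_ge0.
(* Up to the factor [B], this vector is the component of [u] orthogonal to [v]; its squared norm is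
   [B * (enorm u ^+ 2 * B - D ^+ 2)]. *)
have : 0 <= \sum_(j < d) (B * u 0 j - D * v 0 j) ^+ 2.
  by apply: sumr_ge0 => j _; apply: sqr_ge0.
have -> b t : \sum_(j < d) (b * u 0 j - t * v 0 j) ^+ 2 =
    b ^+ 2 * enorm u ^+ 2 - 2 * b * t * dotp u v + t ^+ 2 * enorm v ^+ 2.
  rewrite !sqr_enorm /dotp !mulr_sumr -sumrB -big_split /=.
  by apply: eq_bigr => j _; ring.
rewrite -/D -/B (_ : _ + _ = B * (enorm u ^+ 2 * B - D ^+ 2)); last by ring.
by rewrite pmulr_rge0 // subr_ge0.
Qed.

(** Cauchy-Schwarz puts the argument of [acos] in [-1, 1], where [cos] undoes [acos]. *)
Lemma sqr_cos_angle u w v :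
  cos (angle u w v) ^+ 2 =
  dotp (u - w) (v - w) ^+ 2 / (enorm (u - w) ^+ 2 * enorm (v - w) ^+ 2).
Proof.
have cs := cauchy_schwarz (u - w) (v - w).
rewrite -exprMn in cs *; rewrite -expr_div_n acosK //.
set E := enorm _ * enorm _ in cs *.
rewrite in_itv /= -ler_norml -ler_sqr ?nnegrE // real_normK ?num_real //.
rewrite expr1n expr_div_n.
(* In a degenerate triangle the quotient is 0, by the convention [0^-1 = 0]. *)
have [->|E0] := eqVneq E 0; first by rewrite expr0n /= invr0 mulr0.
by rewrite ler_pdivrMr ?mul1r // lt_def sqrf_eq0 E0 sqr_ge0.
Qed.

Lemma ndist_gt0 N u v : 0 < ndist N u v -> u != v.
Proof.
apply: contraTneq => ->; rewrite /ndist big1 ?sqrtr0 ?mulr0 ?ltxx // => j _.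
by rewrite subrr expr0n.
Qed.

End EuclideanNorm.

Section VertexMoments.
Variables (R : realType) (d N : nat).
Implicit Types (v : lattice d N) (j k : 'I_d).

(** On ['I_N.+1], [rev_ord] is i -> N - i, so this is the reflection in the hyperplane x_j = N/2
    through the center. *)
Definition reflect_coord j v : lattice d N :=
  [ffun i => if i == j then rev_ord (v i) else v i].

Lemma reflect_coordK j : involutive (reflect_coord j).
Proof.
by move=> v; apply/ffunP => i; rewrite !ffunE; case: eqP => // _; rewrite rev_ordK.
Qed.

Lemma reflect_coord_vertices j v :
  (reflect_coord j v \in vertices d N) = (v \in vertices d N).
Proof.
rewrite !inE; apply: eq_forallb => i; rewrite ffunE; case: (i == j) => //=.
rewrite subSS; have : (v i <= N)%N by rewrite -ltnS ltn_ord.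
move: (nat_of_ord (v i)) => m mN. by lia.
Qed.

Definition centered v j : R := (point R v - center R d N) 0 j.

Lemma centeredE v j : centered v j = (v j)%:R - N%:R / 2.
Proof. by rewrite /centered !mxE. Qed.

Lemma centered_reflect j v : centered (reflect_coord j v) j = - centered v j.
Proof.
rewrite !centeredE ffunE eqxx /= subSS natrB; last by rewrite -ltnS ltn_ord.
by lra.
Qed.

Lemma centered_reflect_neq j k v :
  k != j -> centered (reflect_coord j v) k = centered v k.
Proof. by move=> kj; rewrite !centeredE ffunE (negPf kj). Qed.

Lemma sqr_centered_vertex v j :
  v \in vertices d N -> centered v j ^+ 2 = (N%:R / 2) ^+ 2.
Proof.
rewrite inE => /forallP/(_ j) /orP[] /eqP vj; rewrite centeredE vj.
  by rewrite sub0r sqrrN.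
by congr (_ ^+ 2); lra.
Qed.

Lemma sqr_enorm_vertex v : v \in vertices d N ->
  enorm (point R v - center R d N) ^+ 2 = d%:R * (N%:R / 2) ^+ 2.
Proof.
move=> vV; rewrite sqr_enorm (eq_bigr (fun=> (N%:R / 2) ^+ 2)) => [|j _].
  by rewrite sumr_const card_ord [RHS]mulr_natl.
exact: sqr_centered_vertex.
Qed.

Lemma sum_centered_vertices_neq j k : j != k ->
  \sum_(v in vertices d N) centered v j * centered v k = 0.
Proof.
move=> jk; set s := LHS.
(* Reflecting coordinate [j] permutes the vertices and changes the sign of the factor of index [j]
   only. *)
suff : s = - s by lra.
rewrite {1}/s (reindex_inj (inv_inj (reflect_coordK j))) -sumrN.
apply: eq_big => v; first exact: reflect_coord_vertices.
by move=> _; rewrite centered_reflect centered_reflect_neq 1?eq_sym // mulNr.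
Qed.

Lemma sum_sqr_dotp_vertices (x : 'rV[R]_d) :
  \sum_(v in vertices d N) dotp x (point R v - center R d N) ^+ 2 =
  #|vertices d N|%:R * (N%:R / 2) ^+ 2 * enorm x ^+ 2.
Proof.
transitivity (\sum_(j < d) \sum_(k < d)
    x 0 j * x 0 k * \sum_(v in vertices d N) centered v j * centered v k).
  under [RHS]eq_bigr do under eq_bigr do rewrite mulr_sumr.
  under [RHS]eq_bigr do rewrite exchange_big.
  rewrite exchange_big /=; apply: eq_bigr => v _.
  rewrite expr2 /dotp mulr_suml; apply: eq_bigr => j _.
  by rewrite mulr_sumr; apply: eq_bigr => k _; rewrite /centered; ring.
rewrite sqr_enorm mulr_sumr; apply: eq_bigr => j _.
(* Only the diagonal term k = j survives, and there the squared coordinate is the constant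
   (N/2)^2. *)
rewrite (bigD1 j) //= [X in _ + X]big1 ?addr0 => [|k kj].
  rewrite (eq_bigr (fun=> (N%:R / 2) ^+ 2)) => [|v vV].
    by rewrite sumr_const -mulr_natl; ring.
  by rewrite -expr2 sqr_centered_vertex.
by rewrite sum_centered_vertices_neq 1?eq_sym // mulr0.
Qed.

(** All vertices are at the same distance from the center, so the denominator of cos^2 leaves the
    sum and the second moment of the dot product applies. *)
Lemma sum_sqr_cos_vertices (a : lattice d N) :
  (0 < d)%N -> (0 < N)%N -> point R a != center R d N ->
  \sum_(v in vertices d N)
    cos (angle (point R a) (center R d N) (point R v)) ^+ 2 =
  #|vertices d N|%:R / d%:R.
Proof.
move=> d0 N0 ac; set x := point R a - center R d N.
have x0 : enorm x != 0 by rewrite enorm_eq0 subr_eq0.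
under eq_bigr => v vV do rewrite sqr_cos_angle (sqr_enorm_vertex vV).
rewrite -mulr_suml sum_sqr_dotp_vertices -/x.
have dR : d%:R != 0 :> R by rewrite pnatr_eq0 -lt0n.
have NR : N%:R != 0 :> R by rewrite pnatr_eq0 -lt0n.
by field; rewrite dR NR x0.
Qed.

Lemma almost_right_proportion_ge (a : lattice d N) (eps : R) :
  (0 < d)%N -> (0 < N)%N -> 0 < eps -> point R a != center R d N ->
  1 - (d%:R * eps ^+ 2)^-1 <= almost_right_proportion a eps.
Proof.
move=> d0 N0 eps0 ac; rewrite /almost_right_proportion ac /=.
pose C v := cos (angle (point R a) (center R d N) (point R v)).
pose bad := [set v in vertices d N | eps ^+ 2 < C v ^+ 2].
(* The favorable vertices are those outside [bad]: both [eps] and the absolute value are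
   nonnegative, so they compare as their squares do. *)
rewrite [X in _ <= X%:R / _](_ : _ = #|vertices d N :\: bad|)%N; last first.
  apply: eq_card => v; rewrite in_setD [LHS]in_set [v \in bad]in_set.
  case: (v \in vertices d N) => //=; rewrite andbT -leNgt -/(C v) -ler_sqr ?nnegrE ?(ltW eps0) //.
  by rewrite real_normK ?num_real.
have sub : bad \subset vertices d N.
  by apply/subsetP => v; rewrite inE => /andP[].
have V0 : 0 < #|vertices d N|%:R :> R by rewrite card_vertices // ltr0n expn_gt0.
have dR : 0 < d%:R :> R by rewrite ltr0n.
have e2 : 0 < eps ^+ 2 by rewrite exprn_gt0.
have : #|bad|%:R * eps ^+ 2 <= \sum_(v in vertices d N) C v ^+ 2.
  by apply: markov_card => v _; apply: sqr_ge0.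
rewrite sum_sqr_cos_vertices // => badle.
rewrite cardsD (setIidPr sub) natrB ?subset_leq_card //.
rewrite mulrBl divff ?gt_eqF // lerD2l lerN2 ler_pdivrMr //.
rewrite invfM mulrAC ler_pdivlMr //.
by rewrite [X in _ <= X]mulrC.
Qed.

End VertexMoments.

Theorem theorem1p2 (R : realType) (eps : R) (eps_gt0 : 0 < eps) :
  exists (d_eps : nat) (f : nat -> R),
    (forall d : nat, (0 < d)%N -> f d <= 1 / 2) /\
    (forall d N : nat, (0 < d)%N -> (d_eps <= d)%N -> (0 < N)%N ->
      forall a : lattice d N,
        f d <= ndist N (point R a) (center R d N) ->
        1 - eps <= almost_right_proportion a eps).
Proof.
(* From d >= eps^-3 follows 1 / (d eps^2) <= eps. The choice 1 / (d + 1) is positive, which excludes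
   a = c, and is at most 1/2 once d >= 1. *)
exists (Num.truncn (eps ^- 3)).+1, (fun d => d.+1%:R^-1); split=> [d d0|].
  by rewrite div1r lef_pV2 ?posrE ?ltr0n // ler_nat.
move=> d N d0 deps N0 a fa.
have /ndist_gt0 ac : 0 < ndist N (point R a) (center R d N).
  by apply: lt_le_trans fa; rewrite invr_gt0 ltr0n.
apply: le_trans (almost_right_proportion_ge d0 N0 eps_gt0 ac).
have e3 : 0 < eps ^+ 3 by rewrite exprn_gt0.
have dge : eps ^- 3 <= d%:R.
  apply: le_trans (ltW (truncnS_gt _)) _.
  by rewrite ler_nat.
have e2 : 0 < eps ^+ 2 by rewrite exprn_gt0.
have dR : 0 < d%:R :> R by rewrite ltr0n.
rewrite lerD2l lerN2 -[leLHS]mul1r ler_pdivrMr ?mulr_gt0 //.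
move: dge; rewrite -[leLHS]mul1r ler_pdivrMr // => /le_trans; apply.
by rewrite exprS mulrCA.
Qed.
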